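(* Let $k$ be a positive integer and let $\theta$ be a nonnegative real number. Then there exists an infinite word $\mathbf{w}$ such that $\mathcal{A}_k(\mathbf{w})=\theta$, where $\mathcal{A}_k$ denotes the $k$-abelian critical exponent. Moreover, $\mathbf{w}$ can be taken over an alphabet of at most three letters.
   Context: For finite words $u,x$, $|u|_x$ denotes the number of occurrences of $x$ as a factor of $u$. Two finite words $u,v$ are $k$-abelian equivalent, written $u\sim_k v$, if $|u|_x=|v|_x$ for every nonempty word $x$ of length at most $k$. A $k$-abelian power of exponent $e$ (a positive integer) and period $m$ is a nonempty word $u_0u_1\cdots u_{e-1}$ with $|u_0|=m$ and $u_0\sim_k u_1\sim_k\cdots\sim_k u_{e-1}$. For an infinite word $\mathbf{w}$ and positive integer $m$, let $A_{k,\mathbf{w}}(m)$ be the supremum of the exponents of $k$-abelian powers of period $m$ occurring in $\mathbf{w}$. The $k$-abelian critical exponent is $\mathcal{A}_k(\mathbf{w})=\limsup_{m\to\infty} A_{k,\mathbf{w}}(m)/m$. *)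

(* Defs.v *)
From mathcomp Require Import all_boot all_order all_algebra.
From mathcomp Require Import all_classical all_reals all_analysis.
Set Implicit Arguments. Unset Strict Implicit. Unset Printing Implicit Defensive.
Import Order.TTheory GRing.Theory Num.Theory.

Definition occ {T : eqType} (u x : seq T) : nat :=
  count (fun i => take (size x) (drop i u) == x) (iota 0 (size u)).

Definition kab_equiv {T : eqType} (k : nat) (u v : seq T) : Prop :=
  forall x : seq T, 0 < size x -> size x <= k -> occ u x = occ v x.

Definition factor {T : Type} (w : nat -> T) (i n : nat) : seq T :=
  mkseq (fun j => w (i + j)) n.

(* w contains a k-abelian power of exponent e (a positive integer) and
   period m, i.e. a nonempty factor u_0 u_1 ... u_{e-1} with |u_0| = m and
   u_0 ~_k u_1 ~_k ... ~_k u_{e-1}.  Since ~_k (k >= 1) preserves length,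
   every block has length m; the factor starts at some position i. *)
Definition has_kab_power {T : eqType} (k : nat) (w : nat -> T) (m e : nat) : Prop :=
  0 < e /\ 0 < m /\
  exists (i : nat) (l : nat -> nat) (pos : nat -> nat),
    pos 0 = i /\ l 0 = m /\
    (forall j, j < e -> pos j.+1 = pos j + l j) /\
    (forall j, j.+1 < e -> kab_equiv k (factor w (pos j) (l j)) (factor w (pos j.+1) (l j.+1))).

Local Open Scope ereal_scope.

Definition A_kw {R : realType} {T : eqType} (k : nat) (w : nat -> T) (m : nat) : \bar R :=
  ereal_sup [set (e%:R)%:E | e in [set e : nat | has_kab_power k w m e]].

Definition kab_crit_exp {R : realType} {T : eqType} (k : nat) (w : nat -> T) : \bar R :=
  limn_esup (fun m : nat => @A_kw R T k w m * ((m%:R)^-1)%:E).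

(* Main.v *)
(** Passing from k-abelian to abelian equivalence only makes powers more frequent,
    and ordinary powers are k-abelian powers for all k, so the same word serves
    every k. It is the concatenation of the powers x_j ^ e_j, where x_j of length
    m_j is a marker letter followed by a prefix of a binary word without abelian
    fourth powers (Dekking's), e_j is about theta * m_j, and m_j exceeds twice the
    total length of the previous stages. These powers give the lower bound.
    In an abelian power of period m, either no block has a marker, and the exponent
    is at most 3, or every block has one. If m_(j-1) <= m < m_j, the part before
    stage j is short enough to give exponent at most theta * m + O(1), while the
    later markers are at distance at least m_j > m: f blocks of length m there
    satisfy f * (m_j - m) <= m_j and f <= e_j + 1, which again keeps f below
    (theta + eps) * m for large m. *)
Require Import Defs.
From mathcomp Require Import all_boot all_order all_algebra.
From mathcomp Require Import all_classical all_reals all_analysis.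
From mathcomp Require Import zify ring lra.
Set Implicit Arguments. Unset Strict Implicit. Unset Printing Implicit Defensive.
Import Order.TTheory GRing.Theory Num.Theory.

(** * Dekking's binary word as a fixed point of a morphism *)

Definition dek_letter (b : bool) : seq bool :=
  if b then [:: false; false; false; true] else [:: false; true; true].

Definition dek_morph (u : seq bool) : seq bool := flatten (map dek_letter u).

Definition dek_iter (n : nat) : seq bool := iter n dek_morph [:: false].

(** Each iterate is a prefix of the next and [dek_iter n] has more than [n] letters, so the default
    of [nth] is never read. *)
Definition dekking (n : nat) : bool := nth false (dek_iter n) n.

Definition dek_true (n : nat) : nat := count id (mkseq dekking n).

(** Length of the image of the prefix of length [n]: each letter contributes 3, and [true] one
    more. *)
Definition dek_cut (n : nat) : nat := 3 * n + dek_true n.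

Lemma dek_morph_cat u v : dek_morph (u ++ v) = dek_morph u ++ dek_morph v.
Proof. by rewrite /dek_morph map_cat flatten_cat. Qed.

Lemma size_dek_morph u : size (dek_morph u) = 3 * size u + count id u.
Proof.
elim: u => //= b u IHu; rewrite /dek_morph /= size_cat -/(dek_morph u) IHu.
by case: b => /=; lia.
Qed.

Lemma dek_iterS n : dek_iter n.+1 = dek_morph (dek_iter n).
Proof. by []. Qed.

Lemma dek_iter_prefix n : exists v, dek_iter n.+1 = dek_iter n ++ v.
Proof.
elim: n => [|n [v IHn]]; first by exists [:: true; true].
exists (dek_morph v).
by rewrite [LHS]dek_iterS {1}IHn dek_morph_cat -dek_iterS.
Qed.

Lemma size_dek_iter n : n < size (dek_iter n).
Proof.
elim: n => // n IHn; rewrite dek_iterS size_dek_morph.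
lia.
Qed.

Lemma dek_iter_add n p : exists v, dek_iter (n + p) = dek_iter n ++ v.
Proof.
elim: p => [|p [v IHp]]; first by exists [::]; rewrite addn0 cats0.
have [v' E] := dek_iter_prefix (n + p).
by exists (v ++ v'); rewrite addnS E IHp catA.
Qed.

Lemma nth_dek_iter n i : i < size (dek_iter n) -> nth false (dek_iter n) i = dekking i.
Proof.
move=> lt_i; rewrite /dekking.
have [le_ni|/ltnW le_in] := leqP n i.
  have [v] := dek_iter_add n (i - n); rewrite subnKC // => ->.
  by rewrite nth_cat lt_i.
have [v] := dek_iter_add i (n - i); rewrite subnKC // => ->.
by rewrite nth_cat size_dek_iter.
Qed.

Lemma dekking_cut n r : r < 3 + dekking n ->
  dekking (dek_cut n + r) = nth false (dek_letter (dekking n)) r.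
Proof.
move=> lt_r; have lt_n := size_dek_iter n.
have takeE : take n (dek_iter n) = mkseq dekking n.
  apply: (@eq_from_nth _ false) => [|i]; rewrite size_take lt_n ?size_mkseq // => lt_i.
  by rewrite nth_take // nth_mkseq // nth_dek_iter // (ltn_trans lt_i).
have iterE : dek_iter n.+1 = dek_morph (mkseq dekking n) ++
    dek_letter (dekking n) ++ dek_morph (drop n.+1 (dek_iter n)).
  rewrite dek_iterS -{1}(cat_take_drop n (dek_iter n)).
  by rewrite dek_morph_cat takeE (drop_nth false lt_n).
have size_cut : size (dek_morph (mkseq dekking n)) = dek_cut n.
  by rewrite size_dek_morph size_mkseq.
have lt_r' : r < size (dek_letter (dekking n)).
  by move: lt_r; case: (dekking n).
rewrite -(@nth_dek_iter n.+1) iterE.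
  by rewrite nth_cat size_cut ltnNge leq_addr addKn nth_cat lt_r'.
by rewrite !size_cat size_cut; lia.
Qed.

Lemma dek_trueS n : dek_true n.+1 = dek_true n + dekking n.
Proof. by rewrite /dek_true mkseqS -cats1 count_cat /= addn0. Qed.

Lemma dek_cutS n : dek_cut n.+1 = dek_cut n + (3 + dekking n).
Proof. by rewrite /dek_cut dek_trueS; lia. Qed.

Lemma dek_true_cut_add n r : r <= 3 + dekking n ->
  dek_true (dek_cut n + r) =
  dek_true (dek_cut n) + count id (take r (dek_letter (dekking n))).
Proof.
elim: r => [|r IHr] lt_r; first by rewrite addn0 take0 addn0.
rewrite addnS dek_trueS dekking_cut // IHr ?(ltnW lt_r) //.
rewrite (take_nth false) -?cats1 ?count_cat /= ?addn0 ?addnA //.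
by move: lt_r; case: (dekking n).
Qed.

(** The images of [false] and [true] contain two and one letters [true]. *)
Lemma dek_true_cut n : dek_true (dek_cut n) + dek_true n = 2 * n.
Proof.
elim: n => // n IHn; rewrite dek_cutS dek_true_cut_add // dek_trueS.
by case: (dekking n) => /=; lia.
Qed.

Lemma dek_cut_cover p : exists n r, p = dek_cut n + r /\ r < 3 + dekking n.
Proof.
elim: p => [|p [n [r [-> lt_r]]]]; first by exists 0, 0.
have [lt_r1|] := ltnP r.+1 (3 + dekking n); first by exists n, r.+1; rewrite addnS.
move=> ge_r1; exists n.+1, 0; rewrite dek_cutS addn0; split=> //; lia.
Qed.

(** * Synchronization and absence of abelian fourth powers *)

Lemma dek_true_factor n m : dek_true (n + m) =
  dek_true n + count id (mkseq (fun i => dekking (n + i)) m).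
Proof.
elim: m => [|m IHm]; first by rewrite !addn0.
by rewrite addnS dek_trueS IHm mkseqS -cats1 count_cat /= addn0 addnA.
Qed.

Lemma dek_true_bounds n m : dek_true n <= dek_true (n + m) <= dek_true n + m.
Proof.
rewrite dek_true_factor leq_addr leq_add2l.
by rewrite -{2}(size_mkseq (fun i => dekking (n + i)) m) count_size.
Qed.

(* The weight |u|_a + 2 |u|_b vanishes mod 5 on both images of the morphism, and
   no proper prefix of an image has weight 4 mod 5. The weight [c] of a prefix
   also locates the nearest cut: it lies [c] letters a to the left if [c < 3],
   and one letter b to the right if [c = 3]. *)
Lemma dek_sync p (c := (p + dek_true p) %% 5) : c < 4 /\ exists n,
  dek_cut n + (if c == 3 then 0 else c) = p + (c == 3) /\
  dek_true (dek_cut n) = dek_true p + (c == 3).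
Proof.
have [n [r [p_def lt_r]]] := dek_cut_cover p.
have cutE : dek_cut n = 3 * n + dek_true n by [].
have true_cut := dek_true_cut n; have true_p := dek_true_cut_add (ltnW lt_r).
have := @dek_true_cut_add n (3 + dekking n) (leqnn _); rewrite -dek_cutS => true_cutS.
have cutS := dek_cutS n; rewrite -p_def in true_p.
have modE q i : p + dek_true p = 5 * q + i -> i < 5 -> c = i.
  by move=> E lt_i; rewrite /c E mulnC modnMDl modn_small.
case yn: (dekking n) lt_r p_def true_p true_cutS cutS;
  case: r => [|[|[|[|r]]]] //= _ p_def true_p true_cutS cutS;
  first [ have cE : c = 0 by apply: (modE n); lia
        | have cE : c = 1 by apply: (modE n); lia
        | have cE : c = 2 by apply: (modE n); lia
        | have cE : c = 3 by apply: (modE n); lia];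
  rewrite cE /=; split=> //; first [by exists n; lia | by exists n.+1; lia].
Qed.

(** If 5 did not divide [D], the five terms would meet every residue mod 5, including 4. *)
Lemma mod5_progression x D :
  (forall j, j <= 4 -> (x + j * D) %% 5 < 4) -> D %% 5 = 0.
Proof.
move=> lt4; have := (lt4 0 isT, lt4 1 isT, lt4 2 isT, lt4 3 isT, lt4 4 isT).
by case=> -[] [] [] ? ? ? ? ?; lia.
Qed.

(** Descent on [m]: the weights of the five block boundaries avoid 4 mod 5, so 5 divides the block
    weight [m + d]. All boundaries then have the same displacement to a cut, and moving them there
    exhibits the image of a power of smaller period [(m + d) %/ 5]. *)
Lemma dekking_abelian_4_free s m d : 0 < m ->
  ~ (forall j, j <= 4 -> dek_true (s + j * m) = dek_true s + j * d).
Proof.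
elim/ltn_ind: m s d => m IHm s d m_gt0 pow.
have d_le_m : d <= m.
  by have := pow 1 isT; have := dek_true_bounds s m; rewrite !mul1n; lia.
have weightE j : j <= 4 ->
    s + j * m + dek_true (s + j * m) = s + dek_true s + j * (m + d).
  by move=> /pow ->; rewrite mulnDr; lia.
have /eqP md0 : (m + d) %% 5 = 0.
  apply: (@mod5_progression (s + dek_true s)) => j le_j; rewrite -weightE //.
  by case: (dek_sync (s + j * m)).
set q := (m + d) %/ 5; have qE : m + d = q * 5 by rewrite divnK.
pose c := (s + dek_true s) %% 5.
have cut j : j <= 4 -> exists n,
    dek_cut n + (if c == 3 then 0 else c) = s + j * m + (c == 3) /\
    dek_true (dek_cut n) = dek_true s + j * d + (c == 3).
  move=> le_j; have [_] := dek_sync (s + j * m); rewrite weightE // pow //.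
  by rewrite qE mulnA addnC modnMDl.
have [n0 [cut0 true0]] := cut 0 isT.
have n0E := dek_true_cut n0; rewrite true0 /dek_cut in n0E cut0.
have step j : j <= 4 -> dek_true (n0 + j * q) + j * (3 * q) = dek_true n0 + j * m.
  move=> le_j; have [n [cutn truen]] := cut j le_j.
  have nE := dek_true_cut n; rewrite truen /dek_cut in nE cutn.
  have jqE : j * m + j * d = (j * q) * 5 by rewrite -mulnDr qE mulnA.
  (* A prefix ending at [dek_cut n] has weight [5 * n], which determines [n]. *)
  have nE' : n = n0 + j * q by lia.
  by rewrite -nE'; lia.
have le_3q : 3 * q <= m.
  have := step 1 isT; have := dek_true_bounds n0 q; rewrite !mul1n; lia.
apply: (IHm q _ n0 (m - 3 * q)); [lia | lia |].
by move=> j le_j; have := step j le_j; rewrite mulnBr; have := leq_mul (leqnn j) le_3q; lia.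
Qed.

(** * k-abelian, abelian and ordinary powers *)

Lemma occ1 (T : eqType) (u : seq T) x : occ u [:: x] = count_mem x u.
Proof.
rewrite /occ /=; elim: u => //= y u IHu.
rewrite take0 -IHu -(addn0 1) iotaDl count_map eqseq_cons andbT; congr (_ + _).
Qed.

Lemma kab_equiv_perm_eq (T : eqType) k (u v : seq T) :
  0 < k -> kab_equiv k u v -> perm_eq u v.
Proof.
move=> k_gt0 uv; apply/allP => x _ /=; rewrite -!occ1; apply/eqP; exact: uv.
Qed.

Definition abelian_power (T : eqType) (w : nat -> T) (s m e : nat) : Prop :=
  forall j, j < e -> perm_eq (Defs.factor w s m) (Defs.factor w (s + j * m) m).

Lemma has_kab_power_abelian (T : eqType) k (w : nat -> T) m e :
  0 < k -> has_kab_power k w m e -> 0 < m /\ exists s, abelian_power w s m e.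
Proof.
move=> k_gt0 [e_gt0 [m_gt0 [s [l [pos [pos0 [l0 [posS eqv]]]]]]]]; split=> //.
(* The definition lets block lengths vary; the induction also shows that they all equal [m]. *)
exists s => j; suff H : j < e -> [/\ pos j = s + j * m, l j = m
    & perm_eq (Defs.factor w s m) (Defs.factor w (s + j * m) m)] by move=> /H [].
elim: j => [|j IHj] lt_j; first by rewrite addn0.
have [posj lj permj] := IHj (ltnW lt_j).
have := kab_equiv_perm_eq k_gt0 (eqv j lt_j).
have posSj : pos j.+1 = s + j.+1 * m by rewrite posS ?(ltnW lt_j) // posj lj mulSn; lia.
move=> perm_jS; have := perm_size perm_jS; rewrite !size_mkseq lj => lSj.
split=> //; rewrite (perm_trans permj) //.
by rewrite posSj posj lj -lSj in perm_jS.
Qed.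

Lemma periodic_has_kab_power (T : eqType) k (w : nat -> T) s m e :
  0 < e -> 0 < m ->
  (forall q r, q < e -> r < m -> w (s + q * m + r) = w (s + r)) ->
  has_kab_power k w m e.
Proof.
move=> e_gt0 m_gt0 per; split=> //; split=> //.
exists s, (fun=> m), (fun j => s + j * m); split; first by rewrite addn0.
split=> //; split=> [j _|j lt_j]; first by rewrite mulSn; lia.
suff fE q : q < e -> Defs.factor w (s + q * m) m = Defs.factor w s m.
  by rewrite !fE // ltnW.
move=> lt_q; apply/eq_in_map => r; rewrite mem_iota /= => lt_r; exact: per.
Qed.

(** * Stages and markers of the word *)

Fixpoint stage (E : nat -> nat) (j : nat) : nat :=
  if j is i.+1 then stage E i + E (2 * (stage E i).+1) * (2 * (stage E i).+1) else 0.

Definition period (E : nat -> nat) (j : nat) : nat := 2 * (stage E j).+1.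

Lemma stageS E j : stage E j.+1 = stage E j + E (period E j) * period E j.
Proof. by []. Qed.

Lemma periodE E j : period E j = 2 * stage E j + 2.
Proof. by rewrite /period; lia. Qed.

Lemma period_stageS E j : (forall n, 0 < E n) -> stage E j + period E j <= stage E j.+1.
Proof. by move=> E_gt0; rewrite stageS leq_add2l leq_pmull. Qed.

Lemma stage_lt E j : (forall n, 0 < E n) -> stage E j < stage E j.+1.
Proof. by move=> /(period_stageS j); rewrite periodE; lia. Qed.

Lemma stage_le E : (forall n, 0 < E n) -> {homo stage E : i j / i <= j}.
Proof.
by move=> E_gt0; apply: homo_leq leqnn leq_trans _ => i; exact/ltnW/stage_lt.
Qed.

Lemma period_le E : (forall n, 0 < E n) -> {homo period E : i j / i <= j}.
Proof. by move=> E_gt0 i j /(stage_le E_gt0); rewrite !periodE; lia. Qed.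

Lemma double_period E j : (forall n, 0 < E n) -> 2 * period E j <= period E j.+1.
Proof. by move=> /(period_stageS j); rewrite (periodE _ j.+1); lia. Qed.

Lemma stage_ge E j : (forall n, 0 < E n) -> j <= stage E j.
Proof.
move=> E_gt0; elim: j => // j IHj; exact: leq_ltn_trans IHj (stage_lt _ E_gt0).
Qed.

(** Searching below [n] suffices because [j <= stage E j]; a failed search returns [n], which is
    then the right stage. *)
Definition level (E : nat -> nat) (n : nat) : nat :=
  find (fun j => n < stage E j.+1) (iota 0 n).

Lemma level_bounds E n : (forall n, 0 < E n) ->
  stage E (level E n) <= n < stage E (level E n).+1.
Proof.
move=> E_gt0; have le_n : level E n <= n.
  by rewrite -{2}(size_iota 0 n) find_size.
apply/andP; split.
  case lE: (level E n) => [//|j]; rewrite leqNgt; apply/negP => lt_n.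
  have lt_j : j < level E n by rewrite lE.
  have := before_find 0 lt_j; rewrite nth_iota; last by lia.
  by rewrite add0n lt_n.
have [lt_n|ge_n] := ltnP (level E n) n.
  have := nth_find 0 (a := fun j => n < stage E j.+1) (s := iota 0 n).
  by rewrite has_find size_iota -/(level E n) lt_n nth_iota // => /(_ isT).
exact: leq_ltn_trans ge_n (stage_ge _ E_gt0).
Qed.

Lemma levelE E j n : (forall n, 0 < E n) ->
  stage E j <= n < stage E j.+1 -> level E n = j.
Proof.
move=> E_gt0 /andP [le_jn lt_nj]; have /andP [le_ln lt_nl] := level_bounds n E_gt0.
apply/eqP; rewrite eqn_leq; apply/andP; split; rewrite leqNgt; apply/negP.
  by move=> /(stage_le E_gt0); lia.
by move=> /(stage_le E_gt0); lia.
Qed.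

Definition offset (E : nat -> nat) (n : nat) : nat :=
  (n - stage E (level E n)) %% period E (level E n).

Definition letter (b : bool) : 'I_3 := if b then inord 2 else inord 1.

(* Stage [j] occupies the positions from [stage E j] up to [stage E j.+1]; it is
   the power, of exponent [E (period E j)], of the word of length [period E j]
   made of the marker [0] and a prefix of Dekking's word. *)
Definition marked_word (E : nat -> nat) (n : nat) : 'I_3 :=
  if offset E n is r.+1 then letter (dekking r) else ord0.

Lemma letter_neq0 b : letter b != ord0.
Proof. by apply/eqP => /(congr1 val); case: b; rewrite /= inordK. Qed.

Lemma letter_inj : injective letter.
Proof. by move=> [] [] // /(congr1 val); rewrite /= !inordK. Qed.

Lemma marked_word_eq0 E n : (marked_word E n == ord0) = (offset E n == 0).
Proof.
by rewrite /marked_word; case: (offset E n) => [|r]; rewrite ?eqxx // (negPf (letter_neq0 _)).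
Qed.

Lemma offset_stage E j q r : (forall n, 0 < E n) -> q < E (period E j) ->
  r < period E j -> offset E (stage E j + q * period E j + r) = r.
Proof.
move=> E_gt0 lt_q lt_r; rewrite /offset (@levelE E j) //.
  by rewrite -addnA addKn modnMDl modn_small.
apply/andP; split; first by lia.
have := leq_mul lt_q (leqnn (period E j)); rewrite stageS mulSn; lia.
Qed.

Lemma offsetS E n : (forall n, 0 < E n) -> offset E n.+1 != 0 ->
  offset E n.+1 = (offset E n).+1.
Proof.
move=> E_gt0; have /andP [le_n lt_n] := level_bounds n E_gt0.
have [lt_Sn|ge_Sn] := ltnP n.+1 (stage E (level E n).+1).
  have levelS : level E n.+1 = level E n by apply: levelE; rewrite // lt_Sn ltnW.
  by rewrite /offset levelS subSn // modnS; case: ifP.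
have nE : n.+1 = stage E (level E n).+1 by lia.
have -> : offset E n.+1 = 0; last by [].
rewrite nE -[stage _ _]addn0 -[X in X + 0]addn0 -(mul0n (period E (level E n).+1)).
by rewrite offset_stage.
Qed.

Lemma marker_position E n : (forall n, 0 < E n) -> offset E n = 0 ->
  exists2 q, q < E (period E (level E n)) &
  n = stage E (level E n) + q * period E (level E n).
Proof.
move=> E_gt0 off0; have /andP [le_n lt_n] := level_bounds n E_gt0.
exists ((n - stage E (level E n)) %/ period E (level E n)).
  by rewrite ltn_divLR // ltn_subLR // -stageS.
by rewrite divnK ?subnKC //; apply/eqP.
Qed.

(** Within a stage, markers differ by multiples of its period; across stages, the copy begun by the
    first marker ends before the next stage starts. Periods grow with the stage. *)
Lemma marker_gap E j n n' : (forall n, 0 < E n) -> stage E j <= n -> n < n' ->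
  offset E n = 0 -> offset E n' = 0 -> n + period E j <= n'.
Proof.
move=> E_gt0 le_jn lt_nn' off off'.
have /andP [le_n lt_n] := level_bounds n E_gt0.
have /andP [le_n' lt_n'] := level_bounds n' E_gt0.
have le_j : j <= level E n.
  by rewrite leqNgt; apply/negP => /(stage_le E_gt0); lia.
have le_level : level E n <= level E n'.
  by rewrite leqNgt; apply/negP => /(stage_le E_gt0); lia.
have [q lt_q nE] := marker_position E_gt0 off.
have [q' _ n'E] := marker_position E_gt0 off'.
have := period_le E_gt0 le_j; move: le_level; rewrite leq_eqVlt => /orP [/eqP eq_l|lt_l].
  rewrite -eq_l in n'E; have lt_qq' : q < q'.
    by rewrite ltnNge; apply/negP => /leq_mul/(_ (leqnn (period E (level E n)))); lia.
  by have := leq_mul lt_qq' (leqnn (period E (level E n))); rewrite mulSn; lia.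
have := stage_le E_gt0 lt_l; rewrite stageS.
by have := leq_mul lt_q (leqnn (period E (level E n))); rewrite mulSn; lia.
Qed.

(** * Abelian powers in the marked word *)

Lemma marker_free_factor E s L : (forall n, 0 < E n) ->
  (forall t, t < L -> offset E (s + t) != 0) ->
  exists p, forall t, t < L -> marked_word E (s + t) = letter (dekking (p + t)).
Proof.
move=> E_gt0 free; exists (offset E s).-1 => t lt_t.
have offE : offset E (s + t) = offset E s + t.
  elim: t lt_t => [|t IHt] lt_t; first by rewrite !addn0.
  have := free _ lt_t; rewrite !addnS => off; rewrite offsetS // IHt //; exact: ltnW.
have := free 0 (leq_ltn_trans (leq0n t) lt_t); rewrite addn0 => off_s.
rewrite /marked_word offE; by case: (offset E s) off_s.
Qed.

Lemma marker_free_abelian_power E s m e : (forall n, 0 < E n) -> 0 < m ->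
  abelian_power (marked_word E) s m e ->
  (forall t, t < e * m -> offset E (s + t) != 0) -> e <= 3.
Proof.
move=> E_gt0 m_gt0 pow free; rewrite leqNgt; apply/negP => lt3e.
have [p wE] := marker_free_factor E_gt0 free.
have factorE j : j < e -> Defs.factor (marked_word E) (s + j * m) m
    = map letter (mkseq (fun i => dekking (p + j * m + i)) m).
  move=> lt_j; rewrite -map_comp; apply/eq_in_map => r; rewrite mem_iota => /= lt_r.
  rewrite -!addnA wE //.
  by have := leq_mul lt_j (leqnn m); rewrite mulSn; lia.
have countE j : j < e -> count id (mkseq (fun i => dekking (p + j * m + i)) m)
    = count id (mkseq (fun i => dekking (p + i)) m).
  move=> lt_j; have := pow j lt_j; rewrite factorE //.
  have := factorE 0 (leq_ltn_trans (leq0n j) lt_j); rewrite !addn0 => -> /(perm_map_inj letter_inj).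
  by move=> /permP ->.
apply: (dekking_abelian_4_free (s := p) (d := count id (mkseq (fun i => dekking (p + i)) m)) m_gt0).
elim=> [|j IHj] lt_j; first by rewrite !addn0.
by rewrite !mulSnr !addnA dek_true_factor countE ?IHj //; lia.
Qed.

(** Here [a] blocks are spent to reach stage [j] and [f] remain. If one block has a marker, all do,
    and from stage [j] on markers are at least [period E j] apart; fitting [f] of them into length
    [f * m] gives the last inequality. *)
Lemma abelian_power_bound E j s m e : (forall n, 0 < E n) -> 0 < m ->
  m < period E j -> abelian_power (marked_word E) s m e ->
  e <= 3 \/ exists a f, [/\ e <= a + f, a * m <= stage E j + m,
    f <= (E (period E j)).+1 & f * period E j <= f * m + period E j].
Proof.
move=> E_gt0 m_gt0 lt_m pow.
have [ord0_in|no_marker] := boolP (ord0 \in Defs.factor (marked_word E) s m); last first.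
  left; apply: (marker_free_abelian_power E_gt0 m_gt0 pow) => t lt_t.
  have lt_q : t %/ m < e by rewrite ltn_divLR.
  rewrite -marked_word_eq0; apply: contra no_marker => /eqP wt0.
  rewrite (perm_mem (pow _ lt_q)) -wt0.
  apply/mapP; exists (t %% m); first by rewrite mem_iota ltn_mod.
  by rewrite -addnA -divn_eq.
right.
(* The condition [t < e] is under the existential so that [choice] gives a total function. *)
have marker t : exists q, t < e -> [/\ s + t * m <= q, q < s + t * m + m & offset E q = 0].
  have [lt_t|ge_t] := ltnP t e; last by exists 0.
  have : ord0 \in Defs.factor (marked_word E) (s + t * m) m.
    by rewrite -(perm_mem (pow t lt_t)).
  move=> /mapP [r]; rewrite mem_iota => /= lt_r /esym/eqP.
  rewrite marked_word_eq0 => /eqP off; exists (s + t * m + r) => _.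
  by split=> //; lia.
have [Q QP] := choice marker.
pose a := if s < stage E j then ((stage E j - s) %/ m).+1 else 0.
have am : a * m <= stage E j + m.
  rewrite /a; case: ifP => // _; rewrite mulSn.
  by have := leq_trunc_div (stage E j - s) m; lia.
have sa : stage E j <= s + a * m.
  rewrite /a; case: ifP => [lt_s|]; last by lia.
  by have := ltn_ceil (stage E j - s) m_gt0; lia.
have spread u : a + u < e -> Q a + u * period E j <= Q (a + u).
  elim: u => [|u IHu] lt_u; first by rewrite !addn0.
  have lt_u' : a + u < e by lia.
  have {}IHu := IHu lt_u'; have [? ? off_a] := QP a ltac:(lia).
  have [? ? off_u] := QP _ lt_u'; have [? ? off_Su] := QP _ lt_u.
  have lt_Q : Q (a + u) < Q (a + u.+1) by lia.
  have := marker_gap (j := j) E_gt0 _ lt_Q off_u off_Su; rewrite mulSn; lia.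
exists a, (e - a); split=> //; first by lia.
  (* Otherwise [Q (a + f)] lies past stage [j], so the next marker is more than [2 * m] away, too
     far for adjacent blocks. *)
  rewrite leqNgt; apply/negP => lt_f; set f := E (period E j) in lt_f.
  have lt_f1 : a + f < e by lia.
  have lt_f2 : a + f.+1 < e by lia.
  have [? ? _] := QP a ltac:(lia).
  have [? ? off1] := QP _ lt_f1; have [? ? off2] := QP _ lt_f2.
  have lt_Q : Q (a + f) < Q (a + f.+1) by lia.
  have := spread _ lt_f1 => spread_f.
  have le_stage : stage E j.+1 <= Q (a + f) by rewrite stageS -/f; lia.
  have := marker_gap E_gt0 le_stage lt_Q off1 off2.
  by have := double_period j E_gt0; lia.
have [le_ea|lt_ae] := leqP e a; first by rewrite (eqP le_ea); lia.
case fE : (e - a) => [|f]; first by lia.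
have lt_f : a + f < e by lia.
have [? ? _] := QP _ lt_ae; have [? ? _] := QP _ lt_f.
by have := spread _ lt_f; rewrite !mulSn; lia.
Qed.

(** * Real estimates for the exponents *)

Local Open Scope ring_scope.

(** The successor keeps the exponent positive even for [theta = 0], and at least [theta * m]. *)
Definition exponent (R : realType) (theta : R) (m : nat) : nat :=
  (Num.truncn (theta * m%:R)).+1.

Lemma exponent_ge (R : realType) (theta : R) m :
  theta * m%:R <= (exponent theta m)%:R.
Proof. exact/ltW/truncnS_gt. Qed.

Lemma exponent_le (R : realType) (theta : R) m : 0 <= theta ->
  (exponent theta m)%:R <= theta * m%:R + 1.
Proof.
by move=> theta_ge0; rewrite /exponent -natr1 lerD2r truncn_le mulr_ge0.
Qed.

Lemma stageS_le (R : realType) (theta : R) j m : 0 <= theta ->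
  (period (exponent theta) j <= m)%N ->
  (stage (exponent theta) j.+1)%:R <= theta * m%:R ^+ 2 + 2 * m%:R.
Proof.
move=> theta_ge0 le_m; rewrite stageS natrD natrM.
have le_T : (stage (exponent theta) j)%:R <= m%:R :> R.
  by rewrite ler_nat; move: le_m; rewrite periodE; lia.
have := exponent_le (period (exponent theta) j) theta_ge0.
have : (period (exponent theta) j)%:R <= m%:R :> R by rewrite ler_nat.
have : 0 <= (period (exponent theta) j)%:R :> R by [].
move: (period _ j)%:R (exponent _ _)%:R => p x p_ge0 le_pm le_x.
have H1 : x * p <= (theta * p + 1) * p by apply: ler_wpM2r.
have H2 : theta * (p * p) <= theta * (m%:R * m%:R) by apply/ler_wpM2l/ler_pM.
rewrite expr2; lra.
Qed.

(* Near [period j] from below the exponent is at most about [theta * period j]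
   because of the length of stage [j]; farther below, at distance [d], it is at
   most [period j / d], which for [d] at least a constant is negligible. *)
Lemma long_power_bound (R : realType) (theta eps m p f : R) :
  0 <= theta -> 0 < eps -> m < p -> p <= 2 * m -> f <= theta * p + 2 ->
  f * p <= f * m + p -> 4 / eps + 4 * theta / eps ^+ 2 < m ->
  f + 2 <= (theta + eps) * m.
Proof.
move=> theta_ge0 eps_gt0 lt_mp le_p2m le_f gap large; rewrite leNgt; apply/negP => lt_f.
have large' : 4 * eps + 4 * theta < eps ^+ 2 * m.
  have -> : 4 * eps + 4 * theta = eps ^+ 2 * (4 / eps + 4 * theta / eps ^+ 2).
    by field; rewrite gt_eqF.
  by rewrite ltr_pM2l // exprn_gt0.
have m_gt0 : 0 < m by lra.
have em4 : 4 < eps * m.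
  rewrite -(ltr_pM2l eps_gt0) mulrA -expr2 mulrC; lra.
(* By [lt_f] and [em4], [f] exceeds [eps * m / 2], while [f * (p - m) <= p <= 2 * m]. *)
have le_d : eps * (p - m) <= 4.
  have tm_ge0 : 0 <= theta * m by rewrite mulr_ge0 // ltW.
  have H : (eps * m / 2) * (p - m) <= f * (p - m) by apply: ler_wpM2r; lra.
  rewrite -(ler_pM2r m_gt0).
  have -> : eps * (p - m) * m = 2 * (eps * m / 2 * (p - m)) by field.
  lra.
(* So [theta * p] exceeds [theta * m] by at most [4 * theta / eps], which [large'] makes smaller
   than [eps * m - 4]. *)
have : theta * (eps * (p - m)) <= theta * 4 by apply: ler_wpM2l.
have : eps * ((theta + eps) * m) < eps * (theta * p + 4) by rewrite ltr_pM2l //; lra.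
rewrite expr2 in large'; lra.
Qed.

Lemma period_interval (E : nat -> nat) m : (forall n, 0 < E n)%N ->
  (period E 0 <= m)%N -> exists j, (period E j <= m < period E j.+1)%N.
Proof.
move=> E_gt0 le_m; have ex : exists j, (m < period E j)%N.
  by exists m; rewrite periodE; have := stage_ge m E_gt0; lia.
case: (ex_minnP ex) => -[|j] lt_m min; first by lia.
by exists j; rewrite lt_m andbT leqNgt; apply/negP => /min; rewrite ltnn.
Qed.

Lemma abelian_exponent_bound (R : realType) (theta eps : R) :
  0 <= theta -> 0 < eps -> exists N, forall m s e, (N <= m)%N ->
  abelian_power (marked_word (exponent theta)) s m e ->
  e%:R <= (theta + eps) * m%:R.
Proof.
move=> theta_ge0 eps_gt0.
set K := 4 / eps + 4 * theta / eps ^+ 2.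
have E_gt0 n : (0 < exponent theta n)%N by [].
exists (maxn (Num.truncn K).+1 (period (exponent theta) 0)) => m s e.
rewrite geq_max => /andP [le_Km le_pm] pow.
have lt_Km : K < m%:R.
  by apply: lt_le_trans (truncnS_gt K) _; rewrite ler_nat.
have K1 : 4 / eps <= K.
  by rewrite /K lerDl; apply: divr_ge0; [apply: mulr_ge0 | apply/exprn_ge0/ltW].
have em4 : 4 < eps * m%:R.
  by rewrite mulrC -ltr_pdivrMr //; lra.
have [j /andP [le_jm lt_mj]] := period_interval E_gt0 le_pm.
have m_gt0 : (0 < m)%N by lia.
have mR_gt0 : 0 < m%:R :> R by rewrite ltr0n.
have tm_ge0 : 0 <= theta * m%:R by rewrite mulr_ge0.
have [e_le3|[a [f [le_e am f_le gap]]]] := abelian_power_bound E_gt0 m_gt0 lt_mj pow.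
  have : e%:R <= 3 :> R by rewrite (ler_nat _ _ 3).
  by lra.
have le_eR : e%:R <= a%:R + f%:R :> R by rewrite -natrD ler_nat.
(* For [f <= 1] the length before the stage bounds [a]. For [f >= 2], [gap] forces the period to be
   at most [2 * m]; that length is then below [m], and [a] is bounded. *)
have [f_le1|f_gt1] := leqP f 1.
  have : a%:R <= theta * m%:R + 3.
    rewrite -(ler_pM2r mR_gt0) -natrM.
    have : (a * m)%:R <= (stage (exponent theta) j.+1)%:R + m%:R :> R.
      by rewrite -natrD ler_nat.
    by have := stageS_le theta_ge0 le_jm; rewrite expr2; lra.
  have : f%:R <= 1 :> R by rewrite (ler_nat _ _ 1).
  by lra.
have le_p2m : (period (exponent theta) j.+1 <= 2 * m)%N.
  case: f {le_e f_le le_eR} f_gt1 gap => [|[|g]] // _ gap.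
  by rewrite -(@leq_pmul2l g.+1) //; have := leq0n (g * m)%N; lia.
have a_le2 : (a <= 2)%N.
  by rewrite -(leq_pmul2r m_gt0); move: le_p2m; rewrite periodE; lia.
have : a%:R <= 2 :> R by rewrite (ler_nat _ _ 2).
have fR : f%:R <= theta * (period (exponent theta) j.+1)%:R + 2.
  have : f%:R <= (exponent theta (period (exponent theta) j.+1)).+1%:R :> R.
    by rewrite ler_nat.
  rewrite -natr1; have := exponent_le (period (exponent theta) j.+1) theta_ge0; lra.
have : f%:R + 2 <= (theta + eps) * m%:R.
  apply: (@long_power_bound _ _ _ _ (period (exponent theta) j.+1)%:R) => //.
  - by rewrite ltr_nat.
  - by rewrite -(natrM _ 2) ler_nat.
  - by rewrite -!natrM -natrD ler_nat.
by lra.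
Qed.

(** * Limit superior and conclusion *)

(** As an infimum of suprema over neighbourhoods of infinity, [limn_esup] is bounded above by the
    supremum over one tail; each neighbourhood contains a tail, hence an index given by [lb]. *)
Lemma limn_esup_eq (R : realType) (u : nat -> \bar R) (l : R) :
  (forall eps : R, 0 < eps -> exists N, forall n, (N <= n)%N -> (u n <= (l + eps)%:E)%E) ->
  (forall N, exists2 n, (N <= n)%N & (l%:E <= u n)%E) ->
  limn_esup u = l%:E.
Proof.
move=> ub lb; apply/eqP; rewrite eq_le; apply/andP; split.
  apply/lee_addgt0Pr => eps /ub [N leN]; rewrite -EFinD.
  apply: (@le_trans _ _ (ereal_sup [set u n | n in [set n | (N <= n)%N]]))%classic.
    apply: ereal_inf_lbound; exists [set n | (N <= n)%N]%classic => //.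
    exact: nbhs_infty_ge.
  by apply: ge_ereal_sup => _ [n /= le_Nn <-]; exact: leN.
apply/ereal_infP => _ [A [N _ sub_A] <-]; have [n le_Nn le_l] := lb N.
apply: le_trans le_l _; apply: ereal_sup_ubound; exists n => //; exact: sub_A.
Qed.

(* Words over an alphabet of at most three letters are modelled as
   infinite words over 'I_3. *)
Theorem theorem2 (R : realType) (k : nat) (theta : R) :
  (0 < k)%N -> 0 <= theta ->
  exists w : nat -> 'I_3, @kab_crit_exp R _ k w = (theta%:E)%E.
Proof.
move=> k_gt0 theta_ge0; exists (marked_word (exponent theta)).
have E_gt0 n : (0 < exponent theta n)%N by [].
apply: limn_esup_eq => [eps eps_gt0|N].
  have [N bound] := abelian_exponent_bound theta_ge0 eps_gt0.
  exists (maxn 1 N) => m; rewrite geq_max => /andP [m_gt0 le_Nm].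
  have -> : (theta + eps)%:E = (((theta + eps) * m%:R)%:E * (m%:R^-1)%:E)%E.
    by rewrite -EFinM mulfK // pnatr_eq0 -lt0n.
  apply: lee_wpmul2r; first by rewrite lee_fin invr_ge0.
  apply: ge_ereal_sup => _ [e /= pow <-]; rewrite lee_fin.
  by have [_ [s]] := has_kab_power_abelian k_gt0 pow; exact: bound.
(* The power filling stage [N] has ratio at least [theta], and its period is at least [N]. *)
set p := period (exponent theta) N.
have p_gt0 : (0 < p)%N by [].
exists p; first by rewrite /p periodE; have := stage_ge N E_gt0; lia.
have -> : theta%:E = ((theta * p%:R)%:E * (p%:R^-1)%:E)%E.
  by rewrite -EFinM mulfK // pnatr_eq0 -lt0n.
apply: lee_wpmul2r; first by rewrite lee_fin invr_ge0.
apply: (@le_trans _ _ ((exponent theta p)%:R%:E)); first by rewrite lee_fin exponent_ge.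
apply: ereal_sup_ubound; exists (exponent theta p) => //=.
apply: (@periodic_has_kab_power _ _ _ (stage (exponent theta) N)) => // q r lt_q lt_r.
rewrite /marked_word offset_stage //; have := offset_stage (q := 0) E_gt0 (E_gt0 p) lt_r.
by rewrite mul0n addn0 => ->.
Qed.
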